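(* Let $l,l'\ge 1$ be natural numbers, let $r_1,\dots,r_l\in\mathbb{C}$ and let $s_1,\dots,s_{l'}\in\mathbb{C}\setminus\{0\}$. Let $\mathbb{B}=\mathbb{B}(r_1,\dots,r_l;s_1,\dots,s_{l'})$, acting as a bounded linear operator on $c_0$. Then the residual spectrum of $\mathbb{B}$ is $$\sigma_r(\mathbb{B},c_0)=\left\{\lambda\in\mathbb{C}: (|\lambda-r_1|\cdots|\lambda-r_l|)^{1/l}< (|s_1|\cdots|s_{l'}|)^{1/l'}\right\}.$$
   Context: $c_0$ is the Banach space of complex sequences $x=(x_k)_{k\ge 0}$ converging to $0$, with the supremum norm. For an integer $a$ and $n\in\mathbb{N}$, $a\,(\mathrm{mod}\ n)$ denotes the remainder in $\{0,\dots,n-1\}$ of $a$ modulo $n$. The matrix $\mathbb{B}(r_1,\dots,r_l;s_1,\dots,s_{l'})=(b_{ij})_{i,j\ge 0}$ is the infinite lower triangular matrix with $b_{ij}=r_{j(\mathrm{mod}\ l)+1}$ if $i=j$, $b_{ij}=s_{j(\mathrm{mod}\ l')+1}$ if $i=j+1$, and $b_{ij}=0$ otherwise; it acts on $x=(x_k)_{k\ge0}$ by $(\mathbb{B}x)_k=s_{(k-1)(\mathrm{mod}\ l')+1}x_{k-1}+r_{k(\mathrm{mod}\ l)+1}x_k$, with $x_{-1}=0$. The residual spectrum $\sigma_r(T,X)$ is the set of $\lambda\in\mathbb{C}$ for which $T-\lambda I$ is injective on $X$ but its range is not dense in $X$. *)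

(* Defs.v *)
From HB Require Import structures.
From mathcomp Require Import all_boot all_order all_algebra.
From mathcomp Require Import complex.
From mathcomp Require Import all_classical all_reals topology normedtype sequences.

Set Implicit Arguments.
Unset Strict Implicit.
Unset Printing Implicit Defensive.

Import Order.TTheory GRing.Theory Num.Theory.
Import numFieldNormedType.Exports.
Import Normc.
Local Open Scope classical_set_scope.
Local Open Scope ring_scope.
Local Open Scope complex_scope.

Section ResidualSpectrum.
Variables (K : numFieldType) (X : normedModType K).

Definition residual_spectrum (T : {linear X -> X}) : set K :=
  [set lambda | injective (fun x : X => T x - lambda *: x) /\
                ~ dense (range (fun x : X => T x - lambda *: x))].

End ResidualSpectrum.

Section NullSequences.
Variable R : realType.
Implicit Types x y : nat -> R[i].

(* The regular module [R[i]^o] carries the topology of the modulus. *)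
Definition null_seq : {pred (nat -> R[i])} :=
  mem [set x : nat -> R[i] | (x : nat -> R[i]^o) @ \oo --> (0 : R[i]^o)].

Lemma null_seqP x :
  reflect (forall e : R, 0 < e ->
             exists N, forall k, (N <= k)%N -> normc (x k) < e)
          (x \in null_seq).
Proof.
have normE (z : R[i]^o) : `|z| = (normc z)%:C by case: z.
apply: (iffP idP).
  rewrite inE => /cvgrPdist_lt xc e e0.
  have /xc [N _ HN] : 0 < e%:C :> R[i] by rewrite ltcR.
  by exists N => k Nk; have := HN k Nk; rewrite /= sub0r normrN normE ltcR.
move=> xc; rewrite inE; apply/cvgrPdist_lt => e e0.
have eE : e = (complex.Re e)%:C.
  by case: e e0 => a b; rewrite ltcE /= => /andP[/eqP -> _].
have /xc [N HN] : 0 < complex.Re e by rewrite -ltcR -eE.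
by exists N => // k Nk /=; rewrite sub0r normrN eE normE ltcR; exact: HN.
Qed.

Lemma null_seq_submod_closed : submod_closed null_seq.
Proof.
split; first by rewrite inE; exact: (@cvg_cst R[i]^o).
move=> a x y; rewrite !inE => xc yc /=.
rewrite -[0 : R[i]^o]addr0; apply: (@cvgD _ R[i]^o) => //.
by rewrite -(scaler0 _ a); apply: (@cvgZr _ R[i]^o).
Qed.

HB.instance Definition _ :=
  GRing.isSubmodClosed.Build _ _ null_seq null_seq_submod_closed.

Lemma null_seq_has_sup x : x \in null_seq ->
  has_sup (range (fun k => normc (x k))).
Proof.
move=> /null_seqP /(_ 1 ltr01) [N HN].
split; first by exists (normc (x 0%N)), 0%N.
exists (1 + \sum_(i < N) normc (x i)) => _ [k _ <-].
have n0 (z : R[i]) : 0 <= normc z by case: z => a b; exact: sqrtr_ge0.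
have [Nk|kN] := leqP N k.
  by rewrite ler_wpDr ?sumr_ge0// ltW// HN.
rewrite ler_wpDl// (bigD1 (Ordinal kN))//= lerDl.
by rewrite sumr_ge0.
Qed.

End NullSequences.

Arguments null_seq {R}.

Record c0 (R : realType) := C0 {
  c0_val :> nat -> R[i];
  c0P : c0_val \in null_seq }.

Section C0Structure.
Variable R : realType.
Implicit Types x y : c0 R.

HB.instance Definition _ := [isSub for @c0_val R].
HB.instance Definition _ := [Choice of c0 R by <:].
HB.instance Definition _ := [SubChoice_isSubLmodule of c0 R by <:].

Definition c0_sup x : R := sup (range (fun k => normc (x k))).

Lemma normc_le_c0_sup x k : normc (x k) <= c0_sup x.
Proof.
by apply: ub_le_sup; [exact: (null_seq_has_sup (c0P x)).2|exists k].
Qed.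

Lemma c0_sup_le x (M : R) : (forall k, normc (x k) <= M) -> c0_sup x <= M.
Proof.
move=> xM; apply: ge_sup; first exact: (null_seq_has_sup (c0P x)).1.
by move=> _ [k _ <-].
Qed.

Lemma c0_supD x y : c0_sup (x + y) <= c0_sup x + c0_sup y.
Proof.
apply: c0_sup_le => k; apply: (le_trans (le_normcD _ _)).
by rewrite lerD// normc_le_c0_sup.
Qed.

(* A norm over the scalars [R[i]] has to take its values in [R[i]]. *)
Definition c0_norm x : R[i] := (c0_sup x)%:C.

Lemma c0_normD x y : c0_norm (x + y) <= c0_norm x + c0_norm y.
Proof. by rewrite /c0_norm -rmorphD lecR c0_supD. Qed.

Lemma c0_normZ (a : R[i]) x : c0_norm (a *: x) = `|a| * c0_norm x.
Proof.
have le_supZ (b : R[i]) y : c0_sup (b *: y) <= normc b * c0_sup y.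
  apply: c0_sup_le => k; rewrite [X in normc X](_ : _ = b * y k)// normcM.
  by rewrite ler_wpM2l ?normc_le_c0_sup//; case: b => ? ?; exact: sqrtr_ge0.
have -> : `|a| = (normc a)%:C by case: a.
rewrite /c0_norm -rmorphM; congr (_%:C); apply/eqP; rewrite eq_le le_supZ/=.
have [->|a0] := eqVneq a 0.
  rewrite scale0r normc0 mul0r; apply: (le_trans _ (normc_le_c0_sup _ 0%N)).
  exact: sqrtr_ge0.
have na0 : 0 < normc a.
  rewrite lt_neqAle; apply/andP; split; last by case: (a) => ? ?; exact: sqrtr_ge0.
  by rewrite eq_sym; apply: contra a0 => /eqP/eq0_normc ->.
by rewrite -ler_pdivlMl// -normcV -[in leLHS](scalerK a0 x) le_supZ.
Qed.

Lemma c0_norm0_eq0 x : c0_norm x = 0 -> x = 0.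
Proof.
case=> x0; apply/val_inj/funext => k.
apply/eq0_normc/eqP; rewrite eq_le -[X in _ <= X]x0 normc_le_c0_sup /=.
by case: (c0_val x k) => ? ?; exact: sqrtr_ge0.
Qed.

HB.instance Definition _ := @Lmodule_isNormed.Build R[i] (c0 R)
  c0_norm c0_normD c0_normZ c0_norm0_eq0.

End C0Structure.

Section BidiagonalOperator.
Variables (R : realType) (l l' : nat) (r : l.-tuple R[i]) (s : l'.-tuple R[i]).

(* The tuples are indexed from 0, so that [r`_(j %% l)] is the parameter      *)
(* $r_{j \bmod l + 1}$.                                                       *)
Definition bidiag_mx (i j : nat) : R[i] :=
  if i == j then r`_(j %% l) else if i == j.+1 then s`_(j %% l') else 0.

(* [bidiag_mx] being lower triangular, the sum over the whole row [k] stops   *)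
(* at the diagonal.                                                           *)
Definition bidiag_fun (x : nat -> R[i]) (k : nat) : R[i] :=
  \sum_(j < k.+1) bidiag_mx k j * x j.

Lemma bidiag_fun0 x : bidiag_fun x 0%N = r`_0 * x 0%N.
Proof. by rewrite /bidiag_fun big_ord1 /bidiag_mx eqxx mod0n. Qed.

Lemma bidiag_funS x k :
  bidiag_fun x k.+1 = s`_(k %% l') * x k + r`_(k.+1 %% l) * x k.+1.
Proof.
rewrite /bidiag_fun !big_ord_recr /= big1 ?add0r; last first.
  move=> j _; rewrite /bidiag_mx !gtn_eqF ?mul0r// ?ltnS.
    exact: ltn_ord.
  exact/ltnW/ltn_ord.
by rewrite /bidiag_mx eqxx gtn_eqF.
Qed.

Definition bidiag_bound : R :=
  \sum_(z <- s) normc z + \sum_(z <- r) normc z.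

Lemma normc_bidiag_fun_le x k (M : R) :
  normc (x k.-1) <= M -> normc (x k) <= M ->
  normc (bidiag_fun x k) <= bidiag_bound * M.
Proof.
have n0 (z : R[i]) : 0 <= normc z by case: z => a b; exact: sqrtr_ge0.
have nth_le (t : seq R[i]) i : normc t`_i <= \sum_(z <- t) normc z.
  elim: t i => [|z t IH] [|i]; rewrite ?big_nil ?big_cons ?nth_nil ?normc0//=.
    by rewrite lerDl sumr_ge0.
  by rewrite ler_wpDl.
move=> x1 x2; have M0 : 0 <= M by exact: le_trans x2.
case: k x1 x2 => [|k] /= x1 x2; rewrite /bidiag_bound.
  rewrite bidiag_fun0 normcM mulrDl ler_wpDl ?mulr_ge0 ?sumr_ge0//.
  exact: ler_pM.
rewrite bidiag_funS mulrDl (le_trans (le_normcD _ _))//.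
by rewrite !normcM lerD// ler_pM.
Qed.

Lemma bidiag_fun_null_seq x : x \in null_seq -> bidiag_fun x \in null_seq.
Proof.
have B0 : 0 <= bidiag_bound.
  by apply: addr_ge0; apply: sumr_ge0 => -[a b] _; exact: sqrtr_ge0.
move=> /null_seqP xc; apply/null_seqP => e e0.
have B1 : 0 < bidiag_bound + 1 by rewrite ltr_wpDl.
have /xc [N HN] : 0 < e / (bidiag_bound + 1) by rewrite divr_gt0.
exists N.+1 => -[//|k] Nk.
have /le_lt_trans : normc (bidiag_fun x k.+1) <=
    bidiag_bound * (e / (bidiag_bound + 1)).
  by apply: normc_bidiag_fun_le; apply/ltW/HN => //; exact: ltnW.
apply; rewrite mulrCA gtr_pMr// ltr_pdivrMr// mul1r.
by rewrite ltrDl.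
Qed.

Definition bidiag_op (x : c0 R) : c0 R := C0 (bidiag_fun_null_seq (c0P x)).

Lemma bidiag_op_linear : linear bidiag_op.
Proof.
move=> a x y; apply/val_inj/funext => k /=.
rewrite /bidiag_fun [RHS](_ : _ = a * (\sum_(j < k.+1) bidiag_mx k j * x j) +
  \sum_(j < k.+1) bidiag_mx k j * y j)//.
rewrite mulr_sumr -big_split/=; apply: eq_bigr => j _.
by rewrite [(_ + _) (j : nat)](_ : _ = a * x j + y j)// mulrDr mulrCA.
Qed.

HB.instance Definition _ :=
  GRing.isLinear.Build R[i] (c0 R) (c0 R) *:%R bidiag_op bidiag_op_linear.

Lemma bidiag_op_bounded (x : c0 R) : `|bidiag_op x| <= bidiag_bound%:C * `|x|.
Proof.
rewrite [leLHS](_ : _ = (c0_sup (bidiag_op x))%:C)//.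
rewrite [in leRHS](_ : `|x| = (c0_sup x)%:C)// -rmorphM lecR.
apply: c0_sup_le => k.
by apply: normc_bidiag_fun_le; exact: normc_le_c0_sup.
Qed.

Lemma bidiag_op_continuous : continuous bidiag_op.
Proof.
apply: (@bounded_linear_continuous R[i] (c0 R) (c0 R) bidiag_op).
apply/linear_boundedP; exists bidiag_bound%:C.
split; first by rewrite complex_real.
move=> M BM x; apply: (le_trans (bidiag_op_bounded x)).
by rewrite ler_wpM2r// ltW.
Qed.

End BidiagonalOperator.

(* Main.v *)
(* Put a_k = r_k - lambda, b_k = s_k (indices periodic), and let y solve the  *)
(* adjoint recurrence a_k y_k + b_k y_(k+1) = 0 with y_0 = 1.  Over the       *)
(* common period p = l' l, y is multiplied by y_p, whose modulus is           *)
(* prod |lambda - r_i|^l' / prod |s_i|^l; so |y_p| < 1 is the stated          *)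
(* inequality.  If |y_p| < 1, then y is summable and annihilates the range    *)
(* of B - lambda, which is therefore not dense.  If |y_p| >= 1, then, e_k     *)
(* being the unit vectors, e_k = y_k e_0 modulo the range; averaging          *)
(* e_(m p) / y_(m p) over m < n gives vectors of norm at most 1/n congruent   *)
(* to e_0, so e_0, hence every e_k, is in the closure of the range.  The      *)
(* kernel of B - lambda is always trivial.                                    *)
Require Import Defs.
From mathcomp Require Import all_boot all_order all_algebra.
From mathcomp Require Import complex.
From mathcomp Require Import all_classical all_reals topology normedtype sequences.

Import Order.TTheory GRing.Theory Num.Theory.
Import numFieldNormedType.Exports.
Local Open Scope classical_set_scope.
Local Open Scope ring_scope.

(** The dual of c_0 is l^1, and since every b_k is nonzero, a functional that annihilates the range
    of B - lambda must be a multiple of y. Density of the range thus amounts to y not being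
    summable, which by [y_periodM] depends only on |y_p|; [norm_y_period_lt1] translates this into
    the stated inequality. [range_not_dense] rests on the telescoping sum [y_pairing]; [range_dense]
    avoids duality and works with explicit approximations, through [approx_unit_seq0]. Injectivity
    is [shift_injective]. *)

Lemma denseP (K : numFieldType) (X : normedModType K) (A : set X) :
  dense A <->
  forall (v : X) (e : K), 0 < e -> exists w, A w /\ `|v - w| < e.
Proof.
split=> [dA v e e0|dA O [v Ov] oO].
  have [|w [vw Aw]] := dA (ball v e) _ (ball_open v e).
    by exists v; exact: ballxx.
  by exists w; split=> //; move: vw; rewrite -ball_normE.
have /nbhs_ballP[e /= e0 eO] : nbhs v O by exact: open_nbhs_nbhs.
have [w [Aw vw]] := dA v e e0.
by exists w; split=> //; apply: eO; rewrite -ball_normE.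
Qed.

Lemma prod_modn (K : pzSemiRingType) (F : nat -> K) (m n : nat) :
  \prod_(i < n * m) F (i %% m)%N = (\prod_(i < m) F i) ^+ n.
Proof.
elim: n => [|n IH]; first by rewrite big_ord0.
rewrite mulSnr big_split_ord /= IH exprSr; congr (_ * _).
by apply: eq_bigr => i _; rewrite modnMDl modn_small.
Qed.

(** Raising to the power m n is strictly increasing on nonnegative elements and clears both
    roots. *)
Lemma ltr_rootC_expr (C : numClosedFieldType) (m n : nat) (x y : C) :
  (0 < m)%N -> (0 < n)%N -> 0 <= x -> 0 <= y ->
  (m.-root x < n.-root y) = (x ^+ n < y ^+ m).
Proof.
move=> m0 n0 x0 y0.
have mn0 : (0 < m * n)%N by rewrite muln_gt0 m0.
rewrite -(ltr_pXn2r mn0) ?nnegrE ?rootC_ge0//.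
by rewrite [in ltLHS]exprM (mulnC m) exprM !rootCK.
Qed.

(** * Coordinates, norm and unit vectors in c_0 *)

Section NullSequence.
Variable R : realType.
Implicit Types (x : c0 R) (k n : nat).

Lemma normc_normr (z : R[i]) : `|z| = ((Normc.normc z)%:C)%C.
Proof. by case: z. Qed.

Lemma c0_ext x (y : c0 R) : (forall k, x k = y k) -> x = y.
Proof. by move=> xy; apply/val_inj/funext. Qed.

Lemma c0_sumE n (F : 'I_n -> c0 R) k :
  (\sum_i F i) k = \sum_i F i k.
Proof. exact: (big_morph (fun x : c0 R => x k)). Qed.

Lemma le_c0_norm x k : `|x k| <= `|x|.
Proof.
rewrite normc_normr [leRHS](_ : _ = ((c0_sup x)%:C)%C)// lecR.
exact: normc_le_c0_sup.
Qed.

Lemma c0_norm_le x (M : R[i]) : (forall k, `|x k| <= M) -> `|x| <= M.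
Proof.
(* A bound of a modulus is nonnegative, hence real, so the comparison can be made in [R]. *)
move=> xM; have M0 : 0 <= M := le_trans (normr_ge0 _) (xM 0%N).
have ME : M = ((complex.Re M)%:C)%C by rewrite RRe_real// ger0_real.
rewrite ME [leLHS](_ : _ = ((c0_sup x)%:C)%C)// lecR.
by apply: c0_sup_le => k; rewrite -lecR -normc_normr -ME.
Qed.

Lemma c0_cvg0 x (e : R[i]) : 0 < e ->
  exists n, forall k, (n <= k)%N -> `|x k| < e.
Proof.
move=> e0; have eE : e = ((complex.Re e)%:C)%C by rewrite RRe_real// gtr0_real.
have /null_seqP := c0P x => /(_ (complex.Re e)) [|n xn].
  by rewrite -ltcR -eE.
by exists n => k nk; rewrite eE normc_normr ltcR xn.
Qed.

Lemma natcV_lt (e : R[i]) : 0 < e -> exists n : nat, n.+1%:R^-1 < e.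
Proof.
move=> e0; have eE : e = ((complex.Re e)%:C)%C by rewrite RRe_real// gtr0_real.
move: e0; rewrite eE ltcR => e0.
exists (Num.truncn (complex.Re e)^-1).
have -> : (Num.truncn (complex.Re e)^-1).+1%:R^-1 =
    (((Num.truncn (complex.Re e)^-1).+1%:R^-1)%:C)%C :> R[i].
  by rewrite fmorphV rmorph_nat.
by rewrite ltcR -ltf_pV2 ?posrE ?invr_gt0// invrK truncnS_gt.
Qed.

Lemma unit_seq_null n : (fun k => (k == n)%:R : R[i]) \in null_seq.
Proof.
apply/null_seqP => e e0; exists n.+1 => k nk.
by rewrite gtn_eqF// ComplexField.Normc.normc0.
Qed.

Definition unit_seq n : c0 R := C0 (unit_seq_null n).

End NullSequence.

(** * The operator B - lambda, its adjoint recurrence and its kernel *)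

Section Bidiagonal.
Variables (R : realType) (l l' : nat) (r : l.-tuple R[i]) (s : l'.-tuple R[i]).
Variable lambda : R[i].
Hypotheses (l_gt0 : (0 < l)%N) (l'_gt0 : (0 < l')%N).
Hypothesis s_neq0 : forall i : 'I_l', tnth s i != 0.
Implicit Types (x v w : c0 R) (k n : nat) (e : R[i]).

Let shift x : c0 R := bidiag_op r s x - lambda *: x.
Let a k : R[i] := r`_(k %% l) - lambda.
Let b k : R[i] := s`_(k %% l').
Let y k : R[i] := \prod_(j < k) - (a j / b j).
Let p := (l' * l)%N.

Let b_neq0 k : b k != 0.
Proof.
have kl : (k %% l' < l')%N by rewrite ltn_mod.
by have := s_neq0 (Ordinal kl); rewrite (tnth_nth 0).
Qed.

Let p_gt0 : (0 < p)%N. Proof. by rewrite muln_gt0 l'_gt0. Qed.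

Let shift0E x : shift x 0%N = a 0%N * x 0%N.
Proof.
rewrite [LHS](_ : _ = bidiag_fun r s x 0%N - lambda * x 0%N)//.
by rewrite bidiag_fun0 /a mod0n mulrBl.
Qed.

Let shiftSE x k : shift x k.+1 = b k * x k + a k.+1 * x k.+1.
Proof.
rewrite [LHS](_ : _ = bidiag_fun r s x k.+1 - lambda * x k.+1)//.
by rewrite bidiag_funS /a /b mulrBl addrA.
Qed.

Let shiftD x w : shift (x + w) = shift x + shift w.
Proof. by rewrite /shift linearD scalerDr opprD addrACA. Qed.

Let shiftZ (c : R[i]) x : shift (c *: x) = c *: shift x.
Proof. by rewrite /shift linearZ scalerBr !scalerA mulrC. Qed.

Let y_rec k : b k * y k.+1 = - (a k * y k).
Proof.
rewrite /y big_ord_recr /= mulrCA mulrN [b k * _]mulrC divfK//.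
by rewrite mulrN mulrC.
Qed.

(* At an index [k] with [a k = 0] the equation forces [x k.-1 = 0], and then  *)
(* [x] vanishes up to [k] by descent; there are arbitrarily large such [k].   *)
Lemma shift_injective : injective shift.
Proof.
suff ker0 x : shift x = 0 -> x = 0.
  move=> x w xw; apply/eqP; rewrite -subr_eq0; apply/eqP/ker0.
  by rewrite -scaleN1r shiftD shiftZ xw scaleN1r subrr.
move=> Tx0.
have x0 k : b k * x k + a k.+1 * x k.+1 = 0 by rewrite -shiftSE Tx0.
have down k : x k.+1 = 0 -> x k = 0.
  move=> xk; have /eqP := x0 k; rewrite xk mulr0 addr0 mulf_eq0.
  by rewrite (negPf (b_neq0 k)) => /eqP.
have downD n k : x (k + n)%N = 0 -> x k = 0.
  by elim: n => [|n IH]; rewrite ?addn0// addnS => /down.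
apply: c0_ext => k.
have [/existsP[i /eqP ai0]|/existsPn aN0] := boolP [exists i : 'I_l, a i == 0].
  (* The successor of this index is (k + 1) l + i, congruent to i modulo l, so [a] vanishes there;
     the index itself is at least k. *)
  have : x (k * l + l.-1 + i)%N = 0.
    have /eqP := x0 (k * l + l.-1 + i)%N.
    have -> : a (k * l + l.-1 + i).+1 = 0.
      rewrite -addSn -addnS (prednK l_gt0) -mulSnr /a modnMDl modn_small//.
      by move: ai0; rewrite /a modn_small.
    by rewrite mul0r addr0 mulf_eq0 (negPf (b_neq0 _)) => /eqP.
  have kle : (k <= k * l + l.-1 + i)%N.
    by rewrite -addnA (leq_trans _ (leq_addr _ _))// leq_pmulr.
  by rewrite -(subnKC kle) => /downD.
(* With no zero among the a_j, forward substitution from row 0 gives x = 0. *)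
have a_neq0 j : a j != 0.
  have jl : (j %% l < l)%N by rewrite ltn_mod.
  by have := aN0 (Ordinal jl); rewrite /a /= modn_mod.
elim: k => [|k IH].
  have /eqP : a 0%N * x 0%N = 0 by rewrite -shift0E Tx0.
  by rewrite mulf_eq0 (negPf (a_neq0 _)) => /eqP.
have /eqP := x0 k; rewrite IH mulr0 add0r mulf_eq0 (negPf (a_neq0 _)).
by move=> /eqP.
Qed.

(** * Growth of the adjoint solution over a period *)

Lemma y_period k : y (p + k) = y p * y k.
Proof.
rewrite /y big_split_ord /=; congr (_ * _); apply: eq_bigr => i _.
by rewrite /a /b modnMDl /p mulnC modnMDl.
Qed.

Lemma y_periodM n k : y (n * p + k) = y p ^+ n * y k.
Proof.
elim: n => [|n IH]; first by rewrite mul1r.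
by rewrite mulSn -addnA y_period IH exprS mulrA.
Qed.

(** The p factors run l' times through the r_i and l times through the s_i. *)
Lemma norm_y_period :
  `|y p| = (\prod_(i < l) `|lambda - tnth r i|) ^+ l' /
           (\prod_(i < l') `|tnth s i|) ^+ l.
Proof.
rewrite /y normr_prod.
under eq_bigr do rewrite normrN normf_div.
rewrite prodf_div; congr (_ / _).
  rewrite (prod_modn _ (fun k => `|r`_k - lambda|)); congr (_ ^+ _).
  by apply: eq_bigr => i _; rewrite (tnth_nth 0) distrC.
rewrite /p mulnC (prod_modn _ (fun k => `|s`_k|)); congr (_ ^+ _).
by apply: eq_bigr => i _; rewrite (tnth_nth 0).
Qed.

Lemma norm_y_period_lt1 :
  (`|y p| < 1) =
  (l.-root (\prod_(i < l) `|lambda - tnth r i|)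
     < l'.-root (\prod_(i < l') `|tnth s i|)).
Proof.
rewrite ltr_rootC_expr ?prodr_ge0// norm_y_period ltr_pdivrMr ?mul1r//.
by rewrite exprn_gt0// prodr_gt0// => i _; rewrite normr_gt0.
Qed.

(** If S is the sum over one period and q = |y_p|, the sums over m periods satisfy T_(m+1) = S + q
    T_m. The bound S / (1 - q) is the fixed point of this recursion, so induction preserves it; n
    terms are covered by n periods. *)
Lemma y_sum_bounded : `|y p| < 1 ->
  exists C, forall n, \sum_(k < n) `|y k| <= C.
Proof.
move=> q1; have q10 : 0 < 1 - `|y p| by rewrite subr_gt0.
exists ((\sum_(k < p) `|y k|) / (1 - `|y p|)) => n.
set S := \sum_(k < p) `|y k|.
have S0 : 0 <= S by exact: sumr_ge0.
have Sp m : \sum_(k < m * p) `|y k| <= S / (1 - `|y p|).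
  elim: m => [|m IH]; first by rewrite big_ord0 divr_ge0// ltW.
  rewrite mulSn big_split_ord /= -/S.
  under eq_bigr do rewrite y_period normrM.
  rewrite -mulr_sumr -lerBrDl (le_trans (ler_wpM2l _ IH))//.
  rewrite lerBrDl addrC -lerBrDl -[X in _ <= X - _]mul1r -mulrBl mulrC.
  by rewrite divfK ?gt_eqF.
apply: le_trans (Sp n); rewrite -(subnKC (leq_pmulr n p_gt0)) big_split_ord /=.
by rewrite lerDl sumr_ge0.
Qed.

(** * The range is not dense when |y_p| < 1 *)

(** By the adjoint recurrence, b_k y_(k+1) x_k cancels a_k y_k x_k, so the sum telescopes to its
    boundary term. *)
Lemma y_pairing x n : \sum_(0 <= k < n.+1) y k * shift x k = a n * y n * x n.
Proof.
elim: n => [|n IH].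
  by rewrite big_nat1 shift0E /y big_ord0 mul1r mulr1.
transitivity (\sum_(0 <= k < n.+1) y k * shift x k + y n.+1 * shift x n.+1).
  exact: big_nat_recr.
rewrite IH shiftSE mulrDr [y n.+1 * (b n * _)]mulrA.
rewrite (mulrC (y n.+1)) y_rec mulNr addrA subrr add0r mulrA.
by rewrite (mulrC (y _)).
Qed.

(** No point of the range is within 1 / (2 C) of e_0, where C bounds the partial sums of |y_k|.
    Otherwise, pairing v = e_0 - (B - lambda) x with y up to n gives |1 - a_n y_n x_n| < 1/2,
    although the boundary term is itself below 1/2 for large n. *)
Lemma range_not_dense : `|y p| < 1 -> ~ dense (range shift).
Proof.
move=> q1 /denseP dT; have [C yC] := y_sum_bounded q1.
have y0 : y 0%N = 1 by rewrite /y big_ord0.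
have C1 : 1 <= C by have := yC 1%N; rewrite big_ord1 /= y0 normr1.
have C0 : 0 < C by rewrite (lt_le_trans ltr01).
have e0 : 0 < 2%:R^-1 / C by rewrite divr_gt0 ?invr_gt0 ?ltr0n.
have [_ [[x _ <-] xe]] := dT (unit_seq R 0%N) _ e0.
set v := unit_seq R 0 - shift x in xe.
pose M := \sum_(i < l) `|a i|.
have aM k : `|a k| <= M.
  have kl : (k %% l < l)%N by rewrite ltn_mod.
  rewrite /M (bigD1 (Ordinal kl))//= [in `|a (k %% l)|]/a modn_mod lerDl.
  by rewrite sumr_ge0.
have M0 : 0 <= M by exact: sumr_ge0.
(* Here |a_n y_n| is at most (M + 1) C; M + 1 replaces M because M may be 0. *)
have [n xn] : exists n, forall k, (n <= k)%N ->
    `|x k| < 2%:R^-1 / ((M + 1) * C).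
  by apply: c0_cvg0; rewrite divr_gt0 ?invr_gt0 ?mulr_gt0 ?ltr_wpDl.
have : `|1 - a n * y n * x n| < 2%:R^-1.
  have -> : 1 - a n * y n * x n = \sum_(k < n.+1) y k * v k.
    rewrite -y_pairing big_mkord.
    have -> : 1 = \sum_(k < n.+1) y k * unit_seq R 0 k.
      rewrite big_ord_recl /= y0 mul1r big1 ?addr0// => i _.
      by rewrite /= mulr0.
    by rewrite -sumrB; apply: eq_bigr => k _; rewrite -mulrBr.
  apply: (le_lt_trans (ler_norm_sum _ _ _)).
  have : \sum_(k < n.+1) `|y k * v k| <= C * `|v|.
    apply: le_trans (ler_wpM2r (normr_ge0 v) (yC n.+1)).
    rewrite mulr_suml ler_sum// => k _.
    by rewrite normrM ler_wpM2l// le_c0_norm.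
  by move=> /le_lt_trans; apply; rewrite mulrC -ltr_pdivlMr.
have : `|a n * y n * x n| < 2%:R^-1.
  rewrite normrM normrM.
  have yn : `|y n| <= C.
    by apply: le_trans (yC n.+1); rewrite big_ord_recr /= lerDr sumr_ge0.
  have : `|a n| * `|y n| * `|x n| <= (M + 1) * C * `|x n|.
    apply: ler_wpM2r => //; apply: ler_pM => //.
    by rewrite (le_trans (aM n))// lerDl.
  move=> /le_lt_trans; apply; rewrite mulrC -ltr_pdivlMr ?xn//.
  by rewrite mulr_gt0// ltr_wpDl.
move=> h1 h2; have := ltrD h1 h2.
move=> /(le_lt_trans (ler_normD _ _)).
have := splitr (1 : R[i]); rewrite !div1r => <-.
by rewrite addrC subrK normr1 ltxx.
Qed.

(** * The closure of the range ([approx]) is a closed subspace; density when |y_p| >= 1 *)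

Let approx v := forall e, 0 < e -> exists x, `|v - shift x| < e.

Lemma approx_shift x : approx (shift x).
Proof. by move=> e e0; exists x; rewrite subrr normr0. Qed.

Lemma approxD v w : approx v -> approx w -> approx (v + w).
Proof.
move=> av aw e e0.
have e20 : 0 < e / 2%:R by rewrite divr_gt0.
have [x vx] := av _ e20; have [z wz] := aw _ e20.
exists (x + z); rewrite shiftD opprD addrACA [e]splitr.
by rewrite (le_lt_trans (ler_normD _ _))// ltrD.
Qed.

Lemma approxZ (c : R[i]) v : approx v -> approx (c *: v).
Proof.
move=> av e e0.
have c0 : 0 < `|c| + 1 by rewrite ltr_wpDl.
have [x vx] := av _ (divr_gt0 e0 c0); exists (c *: x).
rewrite shiftZ -scalerBr normrZ.
apply: (@le_lt_trans _ _ ((`|c| + 1) * `|v - shift x|)).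
  by rewrite ler_wpM2r// lerDl.
by rewrite mulrC -ltr_pdivlMr.
Qed.

Lemma approxB v w : approx v -> approx w -> approx (v - w).
Proof. by move=> av aw; rewrite -scaleN1r; apply/approxD/approxZ. Qed.

Lemma approx_lim v :
  (forall e, 0 < e -> exists w, approx w /\ `|v - w| < e) -> approx v.
Proof.
move=> vlim e e0; have e20 : 0 < e / 2%:R by rewrite divr_gt0.
have [w [aw vw]] := vlim _ e20; have [x wx] := aw _ e20; exists x.
by rewrite -(subrKA w) [e]splitr (le_lt_trans (ler_normD _ _))// ltrD.
Qed.

Lemma shift_unit_seq k :
  shift (unit_seq R k) = a k *: unit_seq R k + b k *: unit_seq R k.+1.
Proof.
apply: c0_ext => j; rewrite [RHS](_ : _ =
  a k * (j == k)%:R + b k * (j == k.+1)%:R)//.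
case: j => [|j]; first by case: k => [|k]; rewrite shift0E /= !mulr0 ?addr0.
rewrite shiftSE /= eqSS addrC; congr (_ + _).
  by case: eqP => [->|]; rewrite ?mulr0.
by case: eqP => [->|]; rewrite ?mulr0.
Qed.

Lemma unit_seqS k :
  unit_seq R k.+1 = (b k)^-1 *: (shift (unit_seq R k) - a k *: unit_seq R k).
Proof. by rewrite shift_unit_seq addrAC subrr add0r scalerK. Qed.

(** Modulo the range, e_(k+1) is -(a_k / b_k) e_k by [unit_seqS], and these factors multiply up to
    y_k. *)
Lemma approx_unit_seqB k : approx (unit_seq R k - y k *: unit_seq R 0).
Proof.
elim: k => [|k IH].
  rewrite /y big_ord0 scale1r subrr -(subrr (shift 0)).
  by apply: approxB; exact: approx_shift.
have -> : unit_seq R k.+1 - y k.+1 *: unit_seq R 0 = (b k)^-1 *: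
    (shift (unit_seq R k) - a k *: (unit_seq R k - y k *: unit_seq R 0)).
  rewrite unit_seqS -(mulKf (b_neq0 k) (y k.+1)) y_rec -scalerA -scalerBr.
  by congr (_ *: _); rewrite scalerBr scaleNr opprK opprB addrCA addrC scalerA.
by apply/approxZ/approxB; [exact: approx_shift|exact: approxZ].
Qed.

Lemma approx_unit_seq0 : 1 <= `|y p| -> approx (unit_seq R 0).
Proof.
move=> q1; have q0 : 0 < `|y p| by rewrite (lt_le_trans ltr01).
(* Only multiples of p are used: there y is a power of y_p, hence of modulus at least 1. *)
have yE m : y (m * p) = y p ^+ m.
  by rewrite -[(m * p)%N]addn0 y_periodM /y big_ord0 mulr1.
have y_neq0 m : y (m * p) != 0 by rewrite yE expf_neq0// -normr_gt0.
have y_ge1 m : `|y (m * p)|^-1 <= 1.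
  by rewrite yE normrX invf_le1 ?exprn_gt0 ?exprn_ege1.
pose u n := \sum_(m < n) (y (m * p))^-1 *: unit_seq R (m * p).
have au n : approx (n%:R *: unit_seq R 0 - u n).
  elim: n => [|n IH].
    rewrite /u big_ord0 scale0r subrr -(subrr (shift 0)).
    by apply: approxB; exact: approx_shift.
  rewrite /u big_ord_recr /= -/(u n) -natr1 scalerDl scale1r opprD addrACA.
  apply: approxD => //; rewrite -{1}(scalerK (y_neq0 n) (unit_seq R 0)).
  rewrite -scalerBr -opprB scalerN -scaleN1r; apply/approxZ/approxZ.
  exact: approx_unit_seqB.
(* The positions m p are distinct because p > 0, so each coordinate of [u n] is 0 or a single
   coefficient, of modulus at most 1. In the supremum norm the n terms therefore do not add up. *)
have u1 n : `|u n| <= 1.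
  apply: c0_norm_le => k; rewrite /u c0_sumE.
  have [/existsP[m /eqP km]|/existsPn kN] :=
      boolP [exists m : 'I_n, k == (m * p)%N].
    rewrite (bigD1 m)//= big1 ?addr0 => [|j jm].
      rewrite [X in `|X|](_ : _ = (y (m * p))^-1 * (k == m * p)%N%:R)//.
      by rewrite km eqxx mulr1 normfV.
    rewrite [LHS](_ : _ = (y (j * p))^-1 * (k == j * p)%N%:R)//.
    rewrite km eqn_pmul2r//.
    by have := negPf jm; rewrite -val_eqE eq_sym /= => ->; rewrite mulr0.
  rewrite big1 ?normr0// => j _.
  rewrite [LHS](_ : _ = (y (j * p))^-1 * (k == j * p)%N%:R)//.
  by rewrite (negPf (kN j)) mulr0.
apply: approx_lim => e e0; have [n ne] := natcV_lt _ _ e0.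
(* This vector is e_0 - u_(n+1) / (n + 1), at distance at most 1 / (n + 1) from e_0. *)
exists (n.+1%:R^-1 *: (n.+1%:R *: unit_seq R 0 - u n.+1)).
split; first exact: approxZ.
rewrite scalerBr scalerK ?pnatr_eq0// opprB addrC subrK normrZ normfV normr_nat.
by rewrite (le_lt_trans _ ne)// ler_piMr// invr_ge0.
Qed.

Lemma range_dense : 1 <= `|y p| -> dense (range shift).
Proof.
move=> q1; have a0 := approx_unit_seq0 q1.
have ak k : approx (unit_seq R k).
  elim: k => [//|k IH]; rewrite unit_seqS.
  by apply/approxZ/approxB; [exact: approx_shift|exact: approxZ].
apply/denseP => v e e0; suff /(_ e e0)[x vx] : approx v.
  by exists (shift x); split=> //; exists x.
(* Truncations of v are combinations of the e_k and converge to v because v tends to 0. Tails below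
   e / 2 keep the inequality strict after the supremum is taken. *)
apply: approx_lim => {e0}e e0.
have [n vn] := c0_cvg0 _ v _ (divr_gt0 e0 (ltr0Sn _ 1)).
exists (\sum_(k < n) v k *: unit_seq R k); split.
  elim: n {vn} => [|n IH].
    rewrite big_ord0 -(subrr (shift 0)).
    by apply: approxB; exact: approx_shift.
  by rewrite big_ord_recr /=; apply: approxD => //; exact: approxZ.
apply: (@le_lt_trans _ _ (e / 2%:R)); last first.
  by rewrite ltr_pdivrMr// ltr_pMr// ltr1n.
apply: c0_norm_le => k.
rewrite [X in `|X|](_ : _ = v k - (\sum_(k < n) v k *: unit_seq R k) k)//.
rewrite c0_sumE; have [nk|kn] := leqP n k.
  rewrite big1 ?subr0 ?ltW ?vn// => j _.
  rewrite [LHS](_ : _ = v j * (k == j)%:R)// gtn_eqF ?mulr0//.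
  exact: leq_trans nk.
rewrite (bigD1 (Ordinal kn))//= big1 ?addr0 => [|j jk].
  rewrite [X in `|X|](_ : _ = v k - v k * (k == k)%:R)//.
  by rewrite eqxx mulr1 subrr normr0 divr_ge0// ltW.
rewrite [LHS](_ : _ = v j * (k == j)%:R)//.
by rewrite (_ : (k == j) = false) ?mulr0// eq_sym; exact: negbTE.
Qed.

Lemma residual_spectrumP :
  residual_spectrum (bidiag_op r s) lambda <->
  l.-root (\prod_(i < l) `|lambda - tnth r i|)
    < l'.-root (\prod_(i < l') `|tnth s i|).
Proof.
rewrite -norm_y_period_lt1.
split=> [[_ nd]|q1]; last first.
  by split; [exact: shift_injective|exact: range_not_dense].
(* The order of [R[i]] is partial, but both sides are real and so comparable. *)
rewrite real_ltNge ?ger0_real//; apply/negP => q1.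
exact/nd/range_dense.
Qed.

End Bidiagonal.

Theorem theorem3p6 (R : realType) (l l' : nat) (l_gt0 : (0 < l)%N)
    (l'_gt0 : (0 < l')%N) (r : l.-tuple R[i]) (s : l'.-tuple R[i])
    (s_neq0 : forall i : 'I_l', tnth s i != 0) :
  residual_spectrum (bidiag_op r s) =
  [set lambda : R[i] | l.-root (\prod_(i < l) `|lambda - tnth r i|)
                       < l'.-root (\prod_(i < l') `|tnth s i|)].
Proof.
by apply/seteqP; split=> lambda /= /residual_spectrumP; apply.
Qed.
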